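(* Let $\mathbb{I}$ be a physical inertia tensor defined by $\mathbb{I}(\Omega)=\mathbb{J}\Omega+\Omega\mathbb{J}$. (i) If $n=3$ then the identity $\mathbb{I}(a\wedge b)=(Aa)\wedge(Ab)$ holds for arbitrary $a,b\in\mathbb{R}^3$, with $A=\mathrm{diag}[A_1,A_2,A_3]$ and $$A_i=\sqrt{\frac{(J_i+J_j)(J_i+J_k)}{J_j+J_k}},\qquad\{i,j,k\}=\{1,2,3\},$$ where $\mathbb{J}=\mathrm{diag}[J_1,J_2,J_3]$ (with $J_i+J_j>0$ for $i\ne j$). (ii) If $n\ge4$, there exists a diagonal matrix $A$ satisfying $\mathbb{I}(a\wedge b)=(Aa)\wedge(Ab)$ for all $a,b\in\mathbb{R}^n$ if and only if $\mathbb{I}$ is the inertia tensor of an axisymmetric body. In this case, the body frame can be chosen in such a way that $$\mathbb{J}=\mathrm{diag}\left[A_1A_2-\tfrac12A_2^2,\ \tfrac12A_2^2,\dots,\tfrac12A_2^2\right]$$ and $A=\mathrm{diag}[A_1,A_2,\dots,A_2]$, where $A_1,A_2\in\mathbb{R}$ satisfy $A_1\ge A_2/2>0$.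
   Context: $\mathfrak{so}(n)$ is the space of real skew-symmetric $n\times n$ matrices, and $a\wedge b=ab^T-ba^T$ for $a,b\in\mathbb{R}^n$. A linear operator $\mathbb{I}:\mathfrak{so}(n)\to\mathfrak{so}(n)$ is a physical inertia tensor if $\mathbb{I}(\Omega)=\mathbb{J}\Omega+\Omega\mathbb{J}$ for a mass tensor $\mathbb{J}$, which with respect to a principal (orthonormal) body frame is diagonal, $\mathbb{J}=\mathrm{diag}[J_1,\dots,J_n]$, with positive entries; ''diagonal matrix $A$'' refers to such a frame. The body is axisymmetric if at least $n-1$ of the eigenvalues of $\mathbb{J}$ coincide, i.e. in some principal frame $\mathbb{J}=\mathrm{diag}[J_1,J_2,\dots,J_2]$ (the case $J_1=J_2$ being allowed here). *)

(* Defs.v *)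
From HB Require Import structures.
From mathcomp Require Import all_boot all_order all_algebra.

Set Implicit Arguments.
Unset Strict Implicit.
Unset Printing Implicit Defensive.

Import Order.TTheory GRing.Theory Num.Theory.
Local Open Scope ring_scope.

Definition skew_pred (R : rcfType) (n : nat) : {pred 'M[R]_n} :=
  fun Omega => Omega \is skewmx.

Fact skew_predE (R : rcfType) (n : nat) (Omega : 'M[R]_n) :
  (Omega \in @skew_pred R n) = (Omega^T == - Omega).
Proof.
rewrite unfold_in is_hermitianmxE expr1 scaleN1r map_mx_id //.
by rewrite eq_sym -[RHS]eqr_opp opprK.
Qed.

Fact skew_submod_closed (R : rcfType) (n : nat) :
  submod_closed (@skew_pred R n).
Proof.
split; first by rewrite skew_predE trmx0 oppr0.
move=> c A B; rewrite !skew_predE => /eqP hA /eqP hB.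
by rewrite linearP /= hA hB scalerN -opprD.
Qed.

HB.instance Definition _ (R : rcfType) (n : nat) :=
  GRing.isSubmodClosed.Build R 'M[R]_n (@skew_pred R n)
    (@skew_submod_closed R n).

Record so (R : rcfType) (n : nat) := So {
  so_mx :> 'M[R]_n;
  _ : so_mx \in @skew_pred R n
}.

HB.instance Definition _ (R : rcfType) (n : nat) :=
  [isSub for @so_mx R n].
HB.instance Definition _ (R : rcfType) (n : nat) :=
  [Choice of so R n by <:].
HB.instance Definition _ (R : rcfType) (n : nat) :=
  [SubChoice_isSubLmodule of so R n by <:].

Fact wedge_subproof (R : rcfType) (n : nat) (a b : 'cV[R]_n) :
  a *m b^T - b *m a^T \in @skew_pred R n.
Proof. by rewrite skew_predE linearB /= !trmx_mul !trmxK opprB. Qed.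

Definition wedge (R : rcfType) (n : nat) (a b : 'cV[R]_n) : so R n :=
  So (wedge_subproof a b).

(* The columns of Q are the vectors of the frame, so that [frame_diag Q d]
   below is the operator whose matrix with respect to Q is diag[d]. *)
Definition orthonormal_frame (R : rcfType) (n : nat) (Q : 'M[R]_n) : Prop :=
  Q^T *m Q = 1%:M.

Definition frame_diag (R : rcfType) (n : nat) (Q : 'M[R]_n) (d : 'rV[R]_n) :
    'M[R]_n :=
  Q *m diag_mx d *m Q^T.

Definition principal_frame (R : rcfType) (n : nat) (J Q : 'M[R]_n) : Prop :=
  orthonormal_frame Q /\ exists d : 'rV[R]_n, J = frame_diag Q d.

Definition mass_tensor (R : rcfType) (n : nat) (J : 'M[R]_n) : Prop :=
  exists (Q : 'M[R]_n) (d : 'rV[R]_n),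
    [/\ orthonormal_frame Q, J = frame_diag Q d & forall i, 0 < d 0 i].

(* The row (x, y, ..., y). *)
Definition axial (R : rcfType) (n : nat) (x y : R) : 'rV[R]_n :=
  \row_(i < n) (if i == 0%N :> nat then x else y).

Definition axisymmetric (R : rcfType) (n : nat) (J : 'M[R]_n) : Prop :=
  exists (Q : 'M[R]_n) (J1 J2 : R),
    orthonormal_frame Q /\ J = frame_diag Q (axial n J1 J2).

Definition inertia_of (R : rcfType) (n : nat)
    (I : {linear so R n -> so R n}) (J : 'M[R]_n) : Prop :=
  forall Omega : so R n, I Omega = J *m Omega + Omega *m J :> 'M[R]_n.

Definition axisymmetric_inertia (R : rcfType) (n : nat)
    (I : {linear so R n -> so R n}) : Prop :=
  exists J : 'M[R]_n, [/\ mass_tensor J, axisymmetric J & inertia_of I J].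

(* Main.v *)
Require Import Defs.
From HB Require Import structures.
From mathcomp Require Import all_boot all_order all_algebra.
From mathcomp Require Import fingroup perm ring lra.

Set Implicit Arguments.
Unset Strict Implicit.
Unset Printing Implicit Defensive.

Import Order.TTheory GRing.Theory Num.Theory.
Local Open Scope ring_scope.

(** In the principal frame Q of J = frame_diag Q d everything is diagonal: the
bivector q_i /\ q_j of two columns of Q is an eigenvector of the inertia
operator with eigenvalue d_i + d_j, and an eigenvector of
a /\ b |-> Aa /\ Ab with eigenvalue A_i A_j.  The wedge identity is therefore
the system A_i A_j = d_i + d_j, i != j ([wedge_identityP]), and the theorem is
about the solvability of that system.

For three indices the three equations are solved by the stated square roots:
A_i A_j is the square root of (d_i + d_j)^2.

For four distinct indices, A_i A_j + A_k A_l and A_i A_k + A_j A_l both equal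
d_i + d_j + d_k + d_l, so (A_i - A_l) (A_j - A_k) = 0.  Values subject to this
alternative on every quadruple agree off a single index ([near_constant]), and
A_i = A_l forces d_i = d_l; hence d is constant off one index p, which is
axisymmetry.  Conversely, if d is c off p, then A_2 = sqrt (2 c) and
A_1 = (d_p + c) / A_2 solve the system ([axial_factors]); positivity of d makes
the root meaningful and gives A_1 >= A_2 / 2.

Axisymmetry is stated for some frame of some mass tensor of I, whereas A is
sought in a given principal frame of a given J.  Two facts bridge the gap: for
n >= 3 the operator I determines J ([inertia_of_inj]), and being constant off
one index does not depend on the principal frame
([near_constant_of_axisymmetric], [axisymmetric_of_near_constant]). *)

(** * Diagonalizing the wedge identity *)

Lemma fresh_ord n (s : seq 'I_n) : (size s < n)%N -> exists k, k \notin s.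
Proof.
move=> sn; apply/existsP; rewrite -negb_forall; apply/negP => /forallP sub.
have := uniq_leq_size (enum_uniq 'I_n) (s2 := s).
by rewrite -cardE card_ord leqNgt sn => /(_ (fun k _ => sub k)).
Qed.

Section Frames.
Variables (R : rcfType) (n : nat).
Implicit Types (Q J : 'M[R]_n) (d A : 'rV[R]_n) (I : {linear so R n -> so R n}).

Lemma orthonormal_frameV Q : orthonormal_frame Q -> Q *m Q^T = 1%:M.
Proof. exact: mulmx1C. Qed.

Lemma frame_diag_mulQ Q d m (x : 'M[R]_(n, m)) : orthonormal_frame Q ->
  frame_diag Q d *m (Q *m x) = Q *m (diag_mx d *m x).
Proof.
by move=> oQ; rewrite /frame_diag -!mulmxA (mulmxA Q^T) oQ mul1mx.
Qed.

Lemma frame_diagK Q d : orthonormal_frame Q ->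
  Q^T *m frame_diag Q d *m Q = diag_mx d.
Proof.
by move=> oQ; rewrite /frame_diag !mulmxA oQ mul1mx -mulmxA oQ mulmx1.
Qed.

Lemma wedge_inertiaE d (x y : 'cV[R]_n) i j :
  (diag_mx d *m wedge x y + wedge x y *m diag_mx d) i j
  = (d 0 i + d 0 j) * (x i 0 * y j 0 - y i 0 * x j 0).
Proof.
by rewrite mxE mul_diag_mx mul_mx_diag !mxE !big_ord1 !mxE; ring.
Qed.

Lemma wedge_diagE A (x y : 'cV[R]_n) i j :
  (wedge (diag_mx A *m x) (diag_mx A *m y) : 'M_n) i j
  = A 0 i * A 0 j * (x i 0 * y j 0 - y i 0 * x j 0).
Proof.
by rewrite !mul_diag_mx !mxE !big_ord1 !mxE; ring.
Qed.

Lemma wedge_mulQ Q (x y : 'cV[R]_n) :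
  wedge (Q *m x) (Q *m y) = Q *m wedge x y *m Q^T :> 'M_n.
Proof. by rewrite /= !trmx_mul mulmxBr mulmxBl !mulmxA. Qed.

(** Substituting a = Q x, b = Q y turns both sides into Q M Q^T, with
M_ij a multiple of x_i y_j - y_i x_j; this common factor vanishes for i = j,
which is why the diagonal imposes nothing, and is 1 on the pair of basis
vectors e_i, e_j. *)
Lemma wedge_identityP I Q d A :
    orthonormal_frame Q -> inertia_of I (frame_diag Q d) ->
  (forall a b : 'cV[R]_n,
     I (wedge a b) = wedge (frame_diag Q A *m a) (frame_diag Q A *m b))
  <-> (forall i j, i != j -> A 0 i * A 0 j = d 0 i + d 0 j).
Proof.
move=> oQ hI; have oQ' := orthonormal_frameV oQ.
have IE x y : I (wedge (Q *m x) (Q *m y)) = Q *m (diag_mx d *m wedge x y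
    + wedge x y *m diag_mx d) *m Q^T :> 'M_n.
  rewrite hI wedge_mulQ mulmxDr mulmxDl -[in LHS]mulmxA frame_diag_mulQ //.
  rewrite /frame_diag !mulmxA -[_ *m Q^T *m Q]mulmxA oQ mulmx1.
  by rewrite -!mulmxA.
split=> [H i j ij | H a b].
- have := congr1 (@so_mx R n) (H (Q *m delta_mx i 0) (Q *m delta_mx j 0)).
  rewrite !frame_diag_mulQ // IE wedge_mulQ.
  move=> /(congr1 (fun M => Q^T *m M *m Q)).
  rewrite !mulmxA oQ !mul1mx -!mulmxA oQ !mulmx1 => /matrixP/(_ i j).
  rewrite wedge_inertiaE wedge_diagE !mxE !eqxx [j == i]eq_sym (negbTE ij) /=.
  by rewrite mulr0 subr0 !mulr1.
- have QK (x : 'cV_n) : x = Q *m (Q^T *m x) by rewrite mulmxA oQ' mul1mx.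
  rewrite (QK a) (QK b) !frame_diag_mulQ //.
  apply: val_inj; rewrite [LHS]IE [RHS]wedge_mulQ; congr (_ *m _ *m _).
  apply/matrixP => i j; rewrite wedge_inertiaE wedge_diagE.
  by have [->|/H->//] := eqVneq i j; rewrite [_ * _ j 0]mulrC subrr !mulr0.
Qed.

(** * Independence of the frame and of the mass tensor *)

(** The transition matrix P is orthogonal and conjugates diag[d'] into
diag[d]; the two identities are the entries of P^T P = 1 and
P^T diag[d'] P = diag[d]. *)
Lemma change_of_frame Q Q' d d' (P := Q'^T *m Q) :
    orthonormal_frame Q -> orthonormal_frame Q' ->
    frame_diag Q d = frame_diag Q' d' -> forall i j,
  \sum_k P k i * P k j = (i == j)%:R /\
  \sum_k P k i * P k j * d' 0 k = d 0 i *+ (i == j).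
Proof.
move=> oQ oQ' E i j; split.
- have <- : (P^T *m P) i j = (i == j)%:R.
    rewrite /P trmx_mul trmxK -mulmxA (mulmxA Q') orthonormal_frameV //.
    by rewrite mul1mx oQ mxE.
  by rewrite mxE; apply: eq_bigr => k _; rewrite [P^T _ _]mxE.
- have <- : (P^T *m (diag_mx d' *m P)) i j = d 0 i *+ (i == j).
    have := congr1 (fun M : 'M_n => M i j) (frame_diagK d oQ).
    by rewrite E /= [RHS]mxE => <-; rewrite /P trmx_mul trmxK !mulmxA.
  by rewrite mxE; apply: eq_bigr => k _; rewrite mul_diag_mx !mxE; ring.
Qed.

(** Each d_i is a convex combination, with weights P_ki^2, of the positive
eigenvalues exhibited by the mass tensor. *)
Lemma mass_tensor_diag_gt0 Q d : orthonormal_frame Q ->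
  mass_tensor (frame_diag Q d) -> forall i, 0 < d 0 i.
Proof.
move=> oQ [Q' [d' [oQ' E d'_gt0]]] i.
have [] := change_of_frame oQ oQ' E i i.
rewrite eqxx !mulr1n => P1 <-.
have ge0 k : 0 <= (Q'^T *m Q) k i * (Q'^T *m Q) k i * d' 0 k.
  by rewrite mulr_ge0 ?(ltW (d'_gt0 k)) // -expr2 sqr_ge0.
rewrite lt_neqAle sumr_ge0 // andbT; apply/eqP => /esym S0.
have /eqP := oner_neq0 R; apply; rewrite -[LHS]P1 big1 // => k _.
have /eqP := psumr_eq0P (fun k _ => ge0 k) S0 (i := k) isT.
by rewrite mulf_eq0 (gt_eqF (d'_gt0 k)) orbF => /eqP.
Qed.

(** The difference D satisfies D W + W D = 0 for every skew W.  On
W = e_i /\ e_j the (i,j) entry reads D_ii + D_jj = 0, and three such equations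
kill the diagonal; on W = e_j /\ e_k the (i,k) entry, with i, j, k distinct,
is D_ij. *)
Lemma inertia_of_inj I J J' : (3 <= n)%N ->
  inertia_of I J -> inertia_of I J' -> J = J'.
Proof.
move=> n3 hJ hJ'; apply/eqP; rewrite -subr_eq0; apply/eqP.
set D := J - J'.
have DW (W : so R n) : D *m W + W *m D = 0.
  by rewrite mulmxBl mulmxBr addrACA -opprD -hJ -hJ' subrr.
(* With a transparent D, mxE would unfold its entries into those of J - J'. *)
clearbody D.
have hD (i j k l : 'I_n) : D k i * (l == j)%:R - D k j * (l == i)%:R
    + ((k == i)%:R * D j l - (k == j)%:R * D i l) = 0.
  have := DW (wedge (delta_mx i 0) (delta_mx j 0)).
  move=> /matrixP/(_ k l) /=.
  rewrite !trmx_delta !mul_delta_mx mulmxBr mulmxBl.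
  rewrite [RHS]mxE => <-; rewrite !mxE.
  congr (_ - _ + (_ - _)).
  - rewrite (bigD1 i) //= mxE eqxx big1 ?addr0 // => m /negbTE mi.
    by rewrite mxE mi mulr0.
  - rewrite (bigD1 j) //= mxE eqxx big1 ?addr0 // => m /negbTE mi.
    by rewrite mxE mi mulr0.
  - rewrite (bigD1 j) //= mxE eqxx andbT big1 ?addr0 // => m /negbTE mi.
    by rewrite mxE mi andbF mul0r.
  - rewrite (bigD1 i) //= mxE eqxx andbT big1 ?addr0 // => m /negbTE mi.
    by rewrite mxE mi andbF mul0r.
have dsum i j : i != j -> D i i + D j j = 0.
  move=> /negbTE ij; have := hD i j i j.
  by rewrite !eqxx [j == i]eq_sym ij mulr1 mulr0 subr0 mul1r mul0r subr0.
apply/matrixP => i j; rewrite [RHS]mxE.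
have [k] := fresh_ord (n3 : size [:: i; j] < n)%N.
rewrite !inE negb_or => /andP[ki kj].
have [<-|ij] := eqVneq i j.
  have [l] := fresh_ord (n3 : size [:: i; k] < n)%N.
  rewrite !inE negb_or => /andP[li lk].
  have := dsum _ _ ki; have := dsum _ _ li; have := dsum _ _ lk; lra.
have := hD j k i k.
by rewrite !eqxx (negbTE ij) [i == k]eq_sym (negbTE ki) (negbTE kj)
  mulr1 mulr0 !mul0r !subr0 addr0.
Qed.

(** Swapping the axes p and 0 of the frame brings the exceptional value to
the first place. *)
Lemma axisymmetric_of_near_constant Q d p c : orthonormal_frame Q ->
  (forall i, i != p -> d 0 i = c) -> axisymmetric (frame_diag Q d).
Proof.
move=> oQ dc; pose z := Ordinal (leq_ltn_trans (leq0n p) (ltn_ord p)).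
pose S : 'M[R]_n := perm_mx (tperm p z).
have oS : S *m S^T = 1%:M by rewrite /S tr_perm_mx -perm_mxM mulgV perm_mx1.
exists (Q *m S), (d 0 p), c; split.
  rewrite /orthonormal_frame trmx_mul -mulmxA (mulmxA Q^T) oQ mul1mx.
  exact: mulmx1C.
pose e : 'rV[R]_n := \row_i d 0 (tperm p z i).
have -> : axial n (d 0 p) c = e.
  apply/rowP => i; rewrite !mxE.
  case: (tpermP p z i) => [-> | -> // | /eqP ip /eqP iz].
  - case: ifPn => [/eqP p0 | p0]; first by congr (d 0 _); apply: val_inj.
    by rewrite dc //; apply: contraNneq p0 => <-.
  - by rewrite (dc i) // ifN //; apply: contraNneq iz => i0; apply/eqP/val_inj.
rewrite /frame_diag trmx_mul.
have -> : diag_mx e = S^T *m diag_mx d *m S.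
  rewrite /S tr_perm_mx tpermV -row_permE.
  rewrite -[tperm p z in X in _ *m X]tpermV -col_permE.
  by apply/matrixP => i j; rewrite !mxE (inj_eq perm_inj).
rewrite !mulmxA.
by rewrite -[Q *m S *m S^T]mulmxA oS mulmx1 -[_ *m S *m S^T]mulmxA oS mulmx1.
Qed.

(** In the frame Q the axisymmetric operator is J2 + (J1 - J2) v v^T, where v
is the axis, i.e. row z of the transition matrix P.  It is diagonal, so
(J1 - J2) v_i v_p = 0 for i != p: either J1 = J2 or v has a single nonzero
coordinate. *)
Lemma near_constant_of_axisymmetric Q d : (0 < n)%N -> orthonormal_frame Q ->
  axisymmetric (frame_diag Q d) -> exists p c, forall i, i != p -> d 0 i = c.
Proof.
move=> n0 oQ [Q' [J1 [J2 [oQ' E]]]]; pose z := Ordinal n0.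
have := change_of_frame oQ oQ' E; set P := Q'^T *m Q => cf.
have dE i j : d 0 i *+ (i == j) = (J1 - J2) * (P z i * P z j) + J2 *+ (i == j).
  have [] := cf i j; rewrite (bigD1 z) //= => P1; rewrite (bigD1 z) //= => <-.
  rewrite [axial _ _ _ _ z]mxE /= -[J2 in J2 *+ _]mulr1 -mulrnAr -P1.
  have -> : \sum_(k | k != z) P k i * P k j * axial n J1 J2 0 k
         = J2 * \sum_(k | k != z) P k i * P k j.
    rewrite mulr_sumr; apply: eq_bigr => k kz.
    have k0 : k != 0%N :> nat.
      by apply: contraNneq kz => k0; apply/eqP/val_inj.
    by rewrite [axial _ _ _ _ k]mxE ifN // mulrC.
  by ring.
case: (pickP (fun p => P z p != 0)) => [p Pp | P0].
- exists p, J2 => i ip; have := dE i p; have := dE i i.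
  rewrite eqxx (negbTE ip) !mulr1n !mulr0n addr0 => -> /esym/eqP.
  rewrite mulrA mulf_eq0 (negbTE Pp) orbF => /eqP E0.
  by rewrite mulrA E0 mul0r add0r.
- exists z, J2 => i _; have := dE i i; rewrite eqxx !mulr1n => ->.
  by move: (P0 i) => /negbFE/eqP ->; rewrite !mulr0 add0r.
Qed.
End Frames.

(** * Solving the system of products *)

(** If f q and f z differ, f is constant on the remaining indices.  A third
index j has a value different from one of f q and f z, so the alternative
applies to a second pair; with a fourth index common to the complements of
both pairs, it leaves as only exception the element where they meet. *)
Lemma near_constant (n : nat) (V : eqType) (f : 'I_n -> V) : (3 < n)%N ->
  (forall i j k l, uniq [:: i; j; k; l] -> (f i == f l) || (f j == f k)) ->
  exists p c, forall i, i != p -> f i = c.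
Proof.
move=> n4 H.
pose z : 'I_n := Ordinal (ltn_trans (ltn0Sn 2) n4).
case: (pickP (fun q => f q != f z)) => [q fq | const]; last first.
  by exists z, (f z) => i _; apply/eqP/negbFE/const.
have off i l j k : f i != f l -> j \notin [:: i; l] -> k \notin [:: i; l] ->
    f j = f k.
  have [-> //|jk] := eqVneq j k => il ji ki.
  have ilx : i != l by apply: contraNneq il => ->.
  apply/eqP; have := H i j k l; rewrite (negbTE il); apply.
  move: ji ki; rewrite /= !inE !negb_or ![i == _]eq_sym.
  by move=> /andP[-> ->] /andP[-> ->]; rewrite jk eq_sym ilx.
have key i l : f i != f l -> forall j, j \notin [:: i; l] -> f i != f j ->
    exists p c, forall i, i != p -> f i = c.
  move=> il j jil ij; have ilx : i != l by apply: contraNneq il => ->.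
  have [k] := fresh_ord (n4 : size [:: i; l; j] < n)%N.
  rewrite !inE !negb_or => /and3P[ki kl kj].
  exists i, (f l); move=> m mi.
  have lij : l \notin [:: i; j].
    move: jil; rewrite !inE !negb_or => /andP[_ jl].
    by rewrite ![l == _]eq_sym ilx.
  have [->|mj] := eqVneq m j.
    rewrite (off i l j k il jil) ?inE ?negb_or ?ki //.
    by rewrite (off i j k l ij _ lij) // !inE negb_or ki.
  by apply: (off i j m l ij _ lij); rewrite !inE negb_or mi.
have [j jqz] := fresh_ord (ltnW n4 : size [:: q; z] < n)%N.
have [fqj|] := eqVneq (f q) (f j); last exact: key fq j jqz.
apply: (key z q _ j); rewrite 1?eq_sym // -?fqj //.
by move: jqz; rewrite !inE !negb_or andbC.
Qed.

(** The alternative required by [near_constant] is (A_i - A_l) (A_j - A_k) = 0,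
and A_a = A_b gives d_a = d_b by comparing the products with a common A_q. *)
Lemma near_constant_of_products (R : rcfType) (n : nat) (A d : 'rV[R]_n) :
    (3 < n)%N -> (forall i j, i != j -> A 0 i * A 0 j = d 0 i + d 0 j) ->
  exists p c, forall i, i != p -> d 0 i = c.
Proof.
move=> n4 Ad; apply: (near_constant (f := d 0)) n4 _ => i j k l.
have dA a b q : a != q -> b != q -> A 0 a = A 0 b -> d 0 a = d 0 b.
  by move=> aq bq ab; apply: (addIr (d 0 q)); rewrite -!Ad ?ab.
rewrite /= !inE !negb_or !andbT => /and3P[/and3P[ij ik il] /andP[jk jl] kl].
have : (A 0 i - A 0 l) * (A 0 j - A 0 k) = 0.
  have := Ad _ _ ij; have := Ad _ _ ik.
  have := Ad _ _ jl; have := Ad _ _ kl; lra.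
move=> /eqP; rewrite mulf_eq0 !subr_eq0 => /orP[] /eqP E.
  by rewrite (dA i l j) ?eqxx // eq_sym.
by rewrite orbC (dA j k i) ?eqxx // eq_sym.
Qed.

(** With x = J_i + J_j, y = J_i + J_k and z = J_j + J_k, this is A_i A_j = x
for three distinct indices. *)
Lemma sqrt_products (R : rcfType) (x y z : R) : 0 < x -> 0 < y -> 0 < z ->
  Num.sqrt (x * y / z) * Num.sqrt (x * z / y) = x.
Proof.
move=> x0 y0 z0; rewrite -sqrtrM; last by rewrite !(mulr_ge0, invr_ge0) // ltW.
rewrite -[RHS]ger0_norm ?ltW // -sqrtr_sqr; congr (Num.sqrt _).
by field; rewrite !gt_eqF.
Qed.

(** Here x and c are the moments J1 and J2; the equations say A2^2 = 2 c and
A1 A2 = x + c, and A2 / 2 <= A1 amounts to 0 <= x. *)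
Lemma axial_factors (R : rcfType) (x c : R) : 0 < x -> 0 < c ->
  exists A1 A2 : R, [/\ x = A1 * A2 - 2^-1 * A2 ^+ 2, c = 2^-1 * A2 ^+ 2,
    A2 / 2 <= A1 & 0 < A2 / 2].
Proof.
move=> x0 c0; pose s := Num.sqrt (2 * c).
have s0 : 0 < s by rewrite sqrtr_gt0 mulr_gt0.
have s2 : s ^+ 2 = 2 * c by rewrite sqr_sqrtr // mulr_ge0 // ltW.
have cE : c = 2^-1 * s ^+ 2 by rewrite s2; field.
exists ((x + c) / s), s; split => //.
- by rewrite -cE divfK ?gt_eqF // addrK.
- rewrite ler_pdivlMr // mulrAC -expr2 s2 mulrAC divff ?mul1r ?pnatr_eq0 //.
  lra.
- by rewrite divr_gt0.
Qed.

Theorem propositionB1 (R : rcfType) :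
  (forall (I : {linear so R 3 -> so R 3}) (Q : 'M[R]_3) (J : 'rV[R]_3),
     orthonormal_frame Q ->
     (forall i j : 'I_3, i != j -> 0 < J 0 i + J 0 j) ->
     inertia_of I (frame_diag Q J) ->
     exists A : 'rV[R]_3,
       (forall i j k : 'I_3, uniq [:: i; j; k] ->
          A 0 i = Num.sqrt ((J 0 i + J 0 j) * (J 0 i + J 0 k)
                            / (J 0 j + J 0 k))) /\
       (forall a b : 'cV[R]_3,
          I (wedge a b)
          = wedge (frame_diag Q A *m a) (frame_diag Q A *m b)))
  /\
  (forall (n : nat) (I : {linear so R n -> so R n}) (J : 'M[R]_n),
     (4 <= n)%N ->
     mass_tensor J ->
     inertia_of I J ->
     (forall Q : 'M[R]_n, principal_frame J Q ->
        ((exists A : 'rV[R]_n, forall a b : 'cV[R]_n,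
            I (wedge a b)
            = wedge (frame_diag Q A *m a) (frame_diag Q A *m b))
         <-> axisymmetric_inertia I))
     /\
     (axisymmetric_inertia I ->
        exists (Q : 'M[R]_n) (A1 A2 : R),
          [/\ orthonormal_frame Q,
              J = frame_diag Q (axial n (A1 * A2 - 2^-1 * A2 ^+ 2)
                                        (2^-1 * A2 ^+ 2)),
              (forall a b : 'cV[R]_n,
                 I (wedge a b)
                 = wedge (frame_diag Q (axial n A1 A2) *m a)
                         (frame_diag Q (axial n A1 A2) *m b)),
              A2 / 2 <= A1
            & 0 < A2 / 2])).
Proof.
split.
- move=> I Q J oQ J_gt0 hI.
  pose f (i j k : 'I_3) :=
    Num.sqrt ((J 0 i + J 0 j) * (J 0 i + J 0 k) / (J 0 j + J 0 k)).
  (* f is symmetric in its last two arguments, so the two other indices may be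
     listed in either order; cyclic succession lists them in one. *)
  have fC i j k : f i j k = f i k j.
    by rewrite /f [_ * (_ + J 0 k)]mulrC [J 0 j + J 0 k]addrC.
  have AE (i j k : 'I_3) : uniq [:: i; j; k] ->
      (\row_i f i (ordS i) (ordS (ordS i))) 0 i = f i j k.
    rewrite mxE => u.
    have [[-> ->]|[-> ->]] : ordS i = j /\ ordS (ordS i) = k \/
      ordS i = k /\ ordS (ordS i) = j; [ | by [] | exact: fC].
    suff /orP[] : (ordS i == j) && (ordS (ordS i) == k)
        || (ordS i == k) && (ordS (ordS i) == j).
    + by move=> /andP[/eqP-> /eqP->]; left.
    + by move=> /andP[/eqP-> /eqP->]; right.
    by move: i j k u => [[|[|[|//]]] ?] [[|[|[|//]]] ?] [[|[|[|//]]] ?].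
  exists (\row_i f i (ordS i) (ordS (ordS i))).
  split=> //.
  apply/(wedge_identityP _ oQ hI) => i j ij.
  have [k kij] := fresh_ord (isT : size [:: i; j] < 3)%N.
  have u : uniq [:: i; j; k].
    by move: kij; rewrite /= !inE !negb_or ij ![k == _]eq_sym => /andP[-> ->].
  have u' : uniq [:: j; i; k].
    by move: u; rewrite /= !inE !negb_or eq_sym => /and3P[/andP[-> ->] ->].
  rewrite (AE _ _ _ u) (AE _ _ _ u') /f.
  have := u; rewrite /= !inE negb_or andbT => /andP[/andP[_ ik] jk].
  by rewrite [J 0 j + J 0 i]addrC sqrt_products ?J_gt0.
- move=> n I J n4 mJ hJ.
  have n3 := ltnW n4; have n0 := ltn_trans (ltn0Sn 2) n4.
  have axJ : axisymmetric_inertia I <-> axisymmetric J.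
    split=> [[J' [_ aJ' hJ']] | aJ]; last by exists J.
    by rewrite (inertia_of_inj n3 hJ hJ').
  split; last first.
    move=> /axJ [Q [J1 [J2 [oQ JE]]]].
    rewrite JE in mJ hJ *.
    have d_gt0 := mass_tensor_diag_gt0 oQ mJ.
    have := d_gt0 (Ordinal n0); have := d_gt0 (Ordinal (ltnW n3)).
    rewrite !mxE /= => c0 x0.
    have [A1 [A2 [E1 E2 A12 A2_gt0]]] := axial_factors x0 c0.
    exists Q, A1, A2; split; rewrite -?E1 -?E2 //.
    apply/(wedge_identityP _ oQ hJ) => i j ij; rewrite !mxE.
    have [i0|_] := eqVneq (i : nat) 0%N; have [j0|_] := eqVneq (j : nat) 0%N.
    + by case/eqP: ij; apply: val_inj; rewrite /= i0 j0.
    + by rewrite E1 E2; ring.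
    + by rewrite E1 E2; ring.
    + by rewrite E2; field.
  move=> Q [oQ [d JE]]; rewrite axJ.
  rewrite JE in mJ hJ *.
  have d_gt0 := mass_tensor_diag_gt0 oQ mJ.
  split=> [[A /(wedge_identityP _ oQ hJ) Ad] | aJ].
    have [p [c dc]] := near_constant_of_products n4 Ad.
    exact: axisymmetric_of_near_constant oQ dc.
  have [p [c dc]] := near_constant_of_axisymmetric n0 oQ aJ.
  have c_gt0 : 0 < c.
    have [q] := fresh_ord (leq_trans (isT : 1 < 4) n4 : size [:: p] < n)%N.
    by rewrite inE => /dc <-.
  have [A1 [A2 [E1 E2 _ _]]] := axial_factors (d_gt0 p) c_gt0.
  exists (\row_i (if i == p then A1 else A2)).
  apply/(wedge_identityP _ oQ hJ) => i j ij; rewrite !mxE.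
  have [ip|ip] := eqVneq i p; have [jp|jp] := eqVneq j p.
  + by rewrite ip jp eqxx in ij.
  + by rewrite ip (dc j) // E1 E2; ring.
  + by rewrite jp (dc i) // E1 E2; ring.
  + by rewrite !dc // E2; field.
Qed.
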